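(* Let $L$ be an oriented non-split alternating link and let $\overline A_B$ and $\overline A_W$ be the weighted adjacency matrices of its consolidated Tait graphs $G_B^*$ and $G_W^*$, respectively. Then $$CWR_4(L)=\left(\Phi_4(\overline A_B),\Phi_4(\overline A_W)\right),$$ where for a symmetric zero-diagonal matrix $M$ $$\Phi_4(M)=\frac18\left[\operatorname{tr}(M^4)-2\left\|M^{\circ2}\mathbf{1}\right\|_2^2+\operatorname{tr}\left((M^{\circ2})^2\right)\right].$$ Equivalently, if $M=(m_{ij})$, then $$\Phi_4(M)=\frac18\left[\operatorname{tr}(M^4)-2\sum_i\Bigl(\sum_jm_{ij}^2\Bigr)^2+\sum_{i,j}m_{ij}^4\right].$$
   Context: $M^{\circ2}=M\circ M$ is the entrywise (Hadamard) square, $\mathbf{1}$ is the all-ones column vector, and for a column vector $y$ with entries in $\mathbb{Z}[w,r]$, $\|y\|_2^2:=y^{\mathsf T}y=\sum_iy_i^2$. Tait graphs and $CWR$. Let $D$ be a reduced (no nugatory crossings) alternating diagram of an oriented non-split alternating link $L$. The regions of $D$ are checkerboard coloured black and white, so that regions sharing an edge have opposite colours; which class is called black is fixed once and for all by a local rule depending on the over/under pattern at crossings, the same rule for all diagrams (the statement holds for either choice of rule). The Tait graph $G_B$ has one vertex for each black region and one edge for each crossing, joining the black regions meeting at that crossing; $G_W$ is defined in the same way from white regions. Each edge $e$ gets weight $\operatorname{wg}(e)=w$ if the crossing is positive and $r$ if it is negative, where $w,r$ are commuting indeterminates. The consolidated Tait graph $G_B^*$ is the weighted simple graph obtained from $G_B$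 by replacing all parallel edges joining the same pair of vertices by a single edge whose weight is the product of their weights; $G_W^*$ is obtained from $G_W$ likewise. For $i>2$, $CB_i(w,r)=\sum_C\prod_{e\in E(C)}\operatorname{wg}(e)$, summed over all unoriented simple cycles $C$ of length $i$ in $G_B^*$; $CW_i$ is defined analogously from $G_W^*$; and $CWR_i=(CB_i,CW_i)$. It is a known theorem that $CWR_i$ does not depend on the chosen reduced alternating diagram $D$ of $L$; $CWR_i(L)$ denotes the common value. The weighted adjacency matrix of a simple loopless weighted graph has $(i,j)$ entry equal to the weight of the edge $v_iv_j$ if it exists, and $0$ otherwise. *)

(* Defs.v *)
From HB Require Import structures.
From mathcomp Require Import all_boot all_order all_algebra all_fingroup.
From mathcomp Require Import mpoly.
From Stdlib Require Import Relation_Operators ClassicalEpsilon.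

Set Implicit Arguments.
Unset Strict Implicit.
Unset Printing Implicit Defensive.

Import GRing.Theory.
Local Open Scope ring_scope.

(** Oriented link diagrams, as signed Gauss codes.

    A passage [(x, o)] is one of the two traversals of the crossing [x]: on the
    over-strand if [o = true], on the under-strand if [o = false].
    [strand_next] sends a passage to the following one on the same oriented
    component, and [ncircles] counts the components that have no crossing.  For
    a diagram on the sphere, passages, [strand_next] and the crossing signs
    determine each connected component of the diagram up to
    orientation-preserving homeomorphism; the relative position of distinct
    connected components is not recorded, as it does not affect the (split)
    link. *)
Record gauss_code := GaussCode {
  ncross : nat;
  strand_next : {perm 'I_ncross * bool};
  positive : 'I_ncross -> bool;
  ncircles : nat }.

Notation crossing D := 'I_(ncross D).
Notation passage D := (crossing D * bool)%type.

(** The edges of the diagram are the arcs from [p] to [strand_next p].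
    The dart [(p, true)] is that edge travelled along the orientation,
    [(p, false)] the same edge travelled backwards; [arrival] is the passage the
    dart runs into. *)
Notation dart D := (passage D * bool)%type.

Section Codes.
Variable D : gauss_code.

Definition arrival (d : dart D) : passage D :=
  if d.2 then strand_next D d.1 else d.1.

(** Boundary walk of the region on the left of a dart: on arriving at a crossing
    on one strand, turn left onto the other strand.  If the over-strand heads
    north, the under-strand heads west at a positive crossing and east at a
    negative one; hence the turn follows the other strand along its orientation
    exactly in the cases tested below. *)
Definition face_step (d : dart D) : dart D :=
  let q := arrival d in
  let q' := (q.1, ~~ q.2) in
  if d.2 == (q.2 == positive q.1) then (q', true)
  else ((strand_next D)^-1%g q', false).

Definition face (d : dart D) : {set dart D} := [set e | fconnect face_step d e].

(** [strand_next] permutes the passages, so reachability is symmetric. *)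
Definition shadow_adj : rel (crossing D) :=
  [rel x y | [exists o, (strand_next D (x, o)).1 == y]].
Definition nparts : nat := n_comp shadow_adj predT.

(** Euler's formula for the shadow: [ncross] vertices, [2 * ncross] edges; every
    connected part lies on a sphere of its own. *)
Definition planar : bool :=
  fcard face_step predT == (ncross D + 2 * nparts)%N.

(** Connected as a subset of the sphere (crossingless circles included). *)
Definition connected : bool := (nparts + ncircles D == 1)%N.

Definition alternating : bool :=
  [forall p : passage D, (strand_next D p).2 != p.2].

(** Around the crossing [x], the darts that arrive at the passage [(x, o)],
    one along the orientation and one against it, have on their left two opposite
    corners of [x]; the other two corners are obtained from [(x, ~~ o)].  The
    corners with [o = true] are those swept when the over-strand is turned
    clockwise onto the under-strand. *)
Definition corner (x : crossing D) (o s : bool) : dart D :=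
  if s then ((strand_next D)^-1%g (x, o), true) else ((x, o), false).

Definition level (d : dart D) : bool := (arrival d).2.

Lemma level_corner (x : crossing D) (o s : bool) : level (corner x o s) = o.
Proof. by case: s; rewrite /level /arrival /corner //= permKV. Qed.

(** A crossing is nugatory when a simple closed curve on the sphere meets the
    diagram only there, transversally, i.e. when two opposite corners belong to
    the same region. *)
Definition nugatory (x : crossing D) : bool :=
  [exists o, face (corner x o true) == face (corner x o false)].

Definition reduced : bool := [forall x, ~~ nugatory x].

(** Checkerboard colouring of an alternating diagram by the local rule "the
    regions with corners at level [b]". *)
Definition coloured_faces (b : bool) : {set {set dart D}} :=
  [set face d | d : dart D & level d == b].

Lemma level_face_step (d : dart D) :
  alternating -> level (face_step d) = level d.
Proof.
move=> /forallP alt; have flip p : (strand_next D p).2 = ~~ p.2.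
  by move: (alt p); case: (_.2) (p.2) => [] [].
have flipV p : ((strand_next D)^-1%g p).2 = ~~ p.2.
  by rewrite -{2}[p](permKV (strand_next D)) flip negbK.
rewrite /level /face_step; case: (_ == _).
  by rewrite {1}/arrival flip negbK.
by rewrite {1}/arrival flipV negbK.
Qed.

Lemma level_edge_sides (p : passage D) :
  alternating -> level (p, true) = ~~ level (p, false).
Proof.
move=> /forallP /(_ p); rewrite /level /arrival /=.
by case: (_.2) (p.2) => [] [].
Qed.

End Codes.

(** [E] is obtained from [D] by erasing the crossings in [S] from the Gauss code;
    components all of whose crossings are erased become crossingless circles.
    For [S = set0] this says that [D] and [E] are isomorphic. *)
Definition erases (D E : gauss_code) (S : {set crossing D}) : Prop :=
  exists f : crossing E -> crossing D,
    let g (p : passage E) : passage D := (f p.1, p.2) in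
    [/\ injective f,
        f @: [set: crossing E] = ~: S,
        forall y : crossing E, positive y = positive (f y),
        forall p : passage E, exists2 k : nat,
          iter k.+1 (strand_next D) (g p) = g (strand_next E p) &
          forall j : nat, (j < k)%N -> (iter j.+1 (strand_next D) (g p)).1 \in S
      & ncircles E =
        (ncircles D
         + #|[set O in porbits (strand_next D)
               | O \subset [set p : passage D | p.1 \in S]]|)%N].

Definition iso_code (D E : gauss_code) : Prop := erases E (set0 : {set crossing D}).

Definition R1_move (D E : gauss_code) : Prop :=
  exists (x : crossing D) (o : bool),
    strand_next D (x, o) = (x, ~~ o) /\ erases E [set x].

Definition neighbours (D : gauss_code) (p q : passage D) : Prop :=
  strand_next D p = q \/ strand_next D q = p.

(** Opposite signs at two crossings consecutive on both strands mean that the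
    edges joining them bound a bigon. *)
Definition R2_move (D E : gauss_code) : Prop :=
  exists x y : crossing D,
    [/\ x != y, positive x != positive y,
        neighbours (x, true) (y, true), neighbours (x, false) (y, false)
      & erases E [set x; y]].

(** A triangular region with three distinct corners, one of whose sides has both
    its ends at the same level; on each of the three strands, the two passages
    bounding a side are exchanged. *)
Definition R3_move (D E : gauss_code) : Prop :=
  exists d : dart D,
    let e (i : 'I_3) : dart D := iter i (@face_step D) d in
    let p (i : 'I_3) : passage D := (e i).1 in
    let swap : {perm (passage D)} :=
      (\prod_(i < 3) tperm (p i) (strand_next D (p i) : passage D))%g in
    [/\ iter 3 (@face_step D) d = d,
        injective (fun i : 'I_3 => (arrival (e i)).1),
        exists i : 'I_3, (strand_next D (p i)).2 = (p i).2
      & E = @GaussCode (ncross D) (strand_next D ^ swap)%g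
                       (@positive D) (ncircles D)].

Definition diagram : Type := {D : gauss_code | planar D}.
Definition code_of (D : diagram) : gauss_code := sval D.
Coercion code_of : diagram >-> gauss_code.

Definition reidemeister_step (D E : diagram) : Prop :=
  [\/ iso_code D E, R1_move D E, R2_move D E | R3_move D E].

Definition reidemeister : diagram -> diagram -> Prop :=
  clos_refl_sym_trans diagram reidemeister_step.

(** Oriented links up to isotopy: classes of diagrams modulo Reidemeister moves. *)
Record link := Link {
  is_diagram_of : diagram -> Prop;
  link_class : exists D0 : diagram,
    forall D : diagram, is_diagram_of D <-> reidemeister D0 D }.

Definition non_split (L : link) : Prop :=
  forall D : diagram, is_diagram_of L D -> connected D.

Definition alternating_link (L : link) : Prop :=
  exists2 D : diagram, is_diagram_of L D & alternating D.

Definition reduced_alternating_diagram (L : link) (D : diagram) : Prop :=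
  [/\ is_diagram_of L D, alternating D & reduced D].

(** An edge is given by the set of its end-vertices, so that a
    loop has a one-element set of ends. *)
Record wmultigraph (R : Type) := WMultigraph {
  mvertex : finType;
  medge : finType;
  ends : medge -> {set mvertex};
  mweight : medge -> R }.

Record wgraph (R : Type) := WGraph {
  vertex : finType;
  edges : {set {set vertex}};
  weight : {set vertex} -> R }.

Definition consolidate (R : comNzRingType) (G : wmultigraph R) : wgraph R :=
  {| vertex := mvertex G;
     edges := [set ends e | e : medge G];
     weight := fun a => \prod_(e : medge G | ends e == a) mweight e |}.

Section Graph.
Variables (R : comNzRingType) (G : wgraph R).

Definition adjacent : rel (vertex G) := [rel u v | [set u; v] \in edges G].

(** For [t] duplicate-free of size at least 3, the edges of the closed polygon
    through the vertices of [t]; a cycle is identified with its set of edges,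
    hence has neither orientation nor base point. *)
Definition polygon (t : seq (vertex G)) : {set {set vertex G}} :=
  [set [set u; path.next t u] | u in t].

Definition simple_cycles (i : nat) : {set {set {set vertex G}}} :=
  [set polygon t | t : i.-tuple (vertex G) & path.cycle adjacent t && uniq t].

Definition cycle_sum (i : nat) : R :=
  \sum_(C in simple_cycles i) \prod_(a in C) weight a.

Definition adjacency : 'M[R]_#|vertex G| :=
  \matrix_(i, j) (if [set enum_val i; enum_val j] \in edges G
                  then weight [set enum_val i; enum_val j] else 0).

End Graph.

Notation Zwr := {mpoly int[2]}.
Notation Qwr := {mpoly rat[2]}.

Definition var_w : Zwr := 'X_(ord0 : 'I_2).
Definition var_r : Zwr := 'X_(ord_max : 'I_2).

(** Regions of a given colour of a connected alternating diagram.  The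
    crossingless circle bounds one region of each colour. *)
Notation region D b :=
  ({f : {set dart D} | f \in coloured_faces D b} + 'I_(ncircles D))%type.

Lemma corner_face_coloured (D : gauss_code) (b : bool) (x : crossing D) (s : bool) :
  face (corner x b s) \in coloured_faces D b.
Proof. by apply: imset_f; rewrite inE level_corner. Qed.

Definition corner_region (D : gauss_code) (b : bool) (x : crossing D) (s : bool) :
    region D b :=
  inl (exist _ (face (corner x b s)) (corner_face_coloured b x s)).

Definition tait_graph (D : gauss_code) (b : bool) : wmultigraph Zwr :=
  {| mvertex := region D b;
     medge := crossing D;
     ends := fun x => [set corner_region b x true; corner_region b x false];
     mweight := fun x => if positive x then var_w else var_r |}.

(** [rule] is the local rule: black regions are those whose corners have level
    [rule]. *)
Definition G_B (rule : bool) (D : gauss_code) := consolidate (tait_graph D rule).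
Definition G_W (rule : bool) (D : gauss_code) := consolidate (tait_graph D (~~ rule)).

Definition CB (rule : bool) (i : nat) (D : gauss_code) : Zwr :=
  cycle_sum (G_B rule D) i.
Definition CW (rule : bool) (i : nat) (D : gauss_code) : Zwr :=
  cycle_sum (G_W rule D) i.

Definition CWR_diagram (rule : bool) (i : nat) (D : gauss_code) : Zwr * Zwr :=
  (CB rule i D, CW rule i D).

Definition CWR_well_defined (rule : bool) (i : nat) (L : link) : Prop :=
  forall D E : diagram,
    reduced_alternating_diagram L D -> reduced_alternating_diagram L E ->
    CWR_diagram rule i D = CWR_diagram rule i E.

(** The common value of [CWR_diagram] on the reduced alternating diagrams of [L];
    meaningful only when [CWR_well_defined rule i L]. *)
Definition CWR (rule : bool) (i : nat) (L : link) : Zwr * Zwr :=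
  epsilon (inhabits (0, 0))
    (fun c => forall D : diagram,
       reduced_alternating_diagram L D -> CWR_diagram rule i D = c).

(** The factor 1/8 is taken in Q[w,r]. *)
Definition toQ (p : Zwr) : Qwr := map_mpoly (intr : int -> rat) p.

Definition pair_toQ (c : Zwr * Zwr) : Qwr * Qwr := (toQ c.1, toQ c.2).

Definition hadamard_square (R : comNzRingType) (n : nat) (M : 'M[R]_n) : 'M[R]_n :=
  map_mx (fun a => a ^+ 2) M.

Definition sqnorm (R : comNzRingType) (n : nat) (y : 'cV[R]_n) : R :=
  (y^T *m y) 0 0.

Definition Phi4 (n : nat) (M : 'M[Zwr]_n) : Qwr :=
  (8%:R : rat)^-1 *:
    toQ (\tr (M ^+ 4)
         - 2%:R * sqnorm (hadamard_square M *m const_mx 1)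
         + \tr (hadamard_square M ^+ 2)).

Definition Phi4_entries (n : nat) (M : 'M[Zwr]_n) : Qwr :=
  (8%:R : rat)^-1 *:
    toQ (\tr (M ^+ 4)
         - 2%:R * \sum_i (\sum_j M i j ^+ 2) ^+ 2
         + \sum_i \sum_j M i j ^+ 4).

(* Main.v *)
(** Each 4-cycle is the polygon of exactly eight duplicate-free 4-tuples, so
    eight times the cycle sum is the sum of [m_ij m_jk m_kl m_li] over pairwise
    distinct [i, j, k, l].  The diagonal of the adjacency matrix vanishes, since
    a loop in a Tait graph would be a nugatory crossing; hence only the
    coincidences [i = k] and [j = l] have to be removed from [tr (M^4)], by
    inclusion-exclusion. *)
Require Import Defs.
From mathcomp Require Import all_boot all_order all_algebra all_fingroup.
From mathcomp Require Import mpoly.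
From mathcomp Require Import ring.
From Stdlib Require Import ClassicalEpsilon.

Import GRing.Theory.
Local Open Scope ring_scope.

(** * Unordered pairs and explicit 4-tuples *)

Lemma set2_eq (T : finType) (x y a b : T) :
  ([set x; y] == [set a; b]) = (x == a) && (y == b) || (x == b) && (y == a).
Proof.
apply/idP/idP=> [/eqP/setP e|].
  have := e x; have := e y; have := e a; have := e b.
  rewrite !inE !eqxx ?orbT /= ![a == _]eq_sym ![b == _]eq_sym.
  by case: (x == a) (y == a) (x == b) (y == b) => [] [] [] [].
by case/orP=> /andP[/eqP-> /eqP->] //; rewrite setUC.
Qed.

Lemma tuple4_eta (T : Type) (t : 4.-tuple T) :
  t = [tuple tnth t ord0; tnth t (inord 1); tnth t (inord 2); tnth t (inord 3)].
Proof.
apply: val_inj; case: t => [[|x [|y [|z [|v []]]]]] //= s4.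
by rewrite !(tnth_nth x) /= !inordK.
Qed.

Lemma tuple4_ind (T : Type) (P : 4.-tuple T -> Prop) :
  (forall x y z v, P [tuple x; y; z; v]) -> forall t, P t.
Proof. by move=> P4 t; rewrite [t]tuple4_eta. Qed.

Lemma eq_tuple4 (T : eqType) (x y z v a b c d : T) :
  ([tuple x; y; z; v] == [tuple a; b; c; d])
  = [&& x == a, y == b, z == c & v == d].
Proof. by rewrite -val_eqE /= !eqseq_cons andbT. Qed.

(** * Four-cycles as polygons of duplicate-free 4-tuples *)

Section FourCycles.
Variables (R : comNzRingType) (G : wgraph R).
Local Notation V := (vertex G).
Implicit Types a b c d x y z v : V.

Lemma polygon4 a b c d : uniq [:: a; b; c; d] ->
  polygon [:: a; b; c; d]
  = [set [set a; b]; [set b; c]; [set c; d]; [set d; a]].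
Proof.
rewrite /= !inE !negb_or !andbT.
move=> /and3P[/and3P[ab ac ad] /andP[bc bd] cd].
have H := (negPf ab, negPf ac, negPf ad, negPf bc, negPf bd, negPf cd).
(* [H'] turns every comparison into the direction in which [H] states it. *)
have H' := (eq_sym b a, eq_sym c a, eq_sym d a, eq_sym c b, eq_sym d b, eq_sym d c).
have nextE : [/\ path.next [:: a; b; c; d] a = b, path.next [:: a; b; c; d] b = c,
    path.next [:: a; b; c; d] c = d & path.next [:: a; b; c; d] d = a].
  by rewrite /= ?eqxx ?H' ?H ?eqxx.
case: nextE => na nb nc nd.
apply/setP=> e; rewrite !inE; apply/imsetP/idP.
  case=> u; rewrite !inE => /or4P[]/eqP-> ->; rewrite ?na ?nb ?nc ?nd eqxx ?orbT //.
rewrite -!orbA => /or4P[]/eqP->; [exists a|exists b|exists c|exists d];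
  by rewrite ?inE ?eqxx ?orbT // ?na ?nb ?nc ?nd.
Qed.

(** Turns membership of an edge into equations between vertices, so that two polygons can be
    compared edge by edge. *)
Lemma edge_polygon4 a b c d x y : uniq [:: a; b; c; d] ->
  ([set x; y] \in polygon [:: a; b; c; d]) =
  [|| (x == a) && ((y == b) || (y == d)), (x == b) && ((y == a) || (y == c)),
      (x == c) && ((y == b) || (y == d)) | (x == d) && ((y == a) || (y == c))].
Proof.
move=> u; rewrite polygon4 // !inE !set2_eq.
by case: (x == a) (x == b) (x == c) (x == d) (y == a) (y == b) (y == c) (y == d)
  => [] [] [] [] [] [] [] [].
Qed.

(** The closed-walk condition thus depends only on the polygon and transfers between duplicate-free
    tuples sharing it. *)
Lemma cycle_polygon4 a b c d : uniq [:: a; b; c; d] ->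
  path.cycle (adjacent (G := G)) [:: a; b; c; d]
  = (polygon [:: a; b; c; d] \subset edges G).
Proof.
move=> u; rewrite polygon4 // !subUset !sub1set /= andbT.
by rewrite /adjacent /= !andbA.
Qed.

(** Distinct vertices give four distinct sides, so no factor is lost when the sides are collected
    into a set. *)
Lemma prod_polygon4 (F : {set V} -> R) a b c d : uniq [:: a; b; c; d] ->
  \prod_(e in polygon [:: a; b; c; d]) F e
  = F [set a; b] * F [set b; c] * F [set c; d] * F [set d; a].
Proof.
move=> u; rewrite polygon4 //; move: u.
rewrite /= !inE !negb_or !andbT.
move=> /and3P[/and3P[ab ac ad] /andP[bc bd] cd].
have H := (negPf ab, negPf ac, negPf ad, negPf bc, negPf bd, negPf cd).
have H' := (eq_sym b a, eq_sym c a, eq_sym d a, eq_sym c b, eq_sym d b, eq_sym d c).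
rewrite -!setUA !big_setU1 ?big_set1 /=; first by ring.
all: by rewrite !inE !set2_eq ?eqxx ?H' ?H.
Qed.

(** The orbit of [(a, b, c, d)] under the dihedral group of order 8: four rotations, then four
    reflections. *)
Definition dihedral4 a b c d : seq (4.-tuple V) :=
  [:: [tuple a; b; c; d]; [tuple b; c; d; a]; [tuple c; d; a; b];
      [tuple d; a; b; c]; [tuple a; d; c; b]; [tuple d; c; b; a];
      [tuple c; b; a; d]; [tuple b; a; d; c]].

(** The pair [(x, y)] is one of the four sides in one of two directions; then [z] has to be the
    neighbour of [y] other than [x], and [v] that of [z] other than [y]. This leaves eight
    tuples. *)
Lemma polygon4_eq a b c d (t : 4.-tuple V) : uniq [:: a; b; c; d] ->
  uniq t && (polygon t == polygon [:: a; b; c; d]) = (t \in dihedral4 a b c d).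
Proof.
move=> u; elim/tuple4_ind: t => x y z v.
rewrite !inE !eq_tuple4 [tval _]/=.
apply/idP/idP.
  case/andP=> u' /eqP E.
  (* Three sides of the first polygon, tested for membership in the second, already determine the
     tuple. *)
  have exy := edge_polygon4 _ _ _ _ x y u'; have exy' := edge_polygon4 _ _ _ _ x y u.
  have eyz := edge_polygon4 _ _ _ _ y z u'; have eyz' := edge_polygon4 _ _ _ _ y z u.
  have ezv := edge_polygon4 _ _ _ _ z v u'; have ezv' := edge_polygon4 _ _ _ _ z v u.
  move: exy eyz ezv; rewrite E {}exy' {}eyz' {}ezv' !eqxx ?orbT /=.
  move: u' u; rewrite /= !inE !negb_or !andbT.
  move=> /and3P[/and3P[xy xz xv] /andP[yz yv] zv].
  move=> /and3P[/and3P[ab ac ad] /andP[bc bd] cd].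
  have H := (negPf ab, negPf ac, negPf ad, negPf bc, negPf bd, negPf cd).
  have H' := (eq_sym b a, eq_sym c a, eq_sym d a, eq_sym c b, eq_sym d b, eq_sym d c).
  move=> + + + {E}.
  case/or4P=> /andP[/eqP ? /orP[]/eqP ?]; subst x y;
    rewrite ?eqxx ?H' ?H /= ?orbF => /orP[]/eqP ?; subst z;
    rewrite ?eqxx // in xz *;
    rewrite ?eqxx ?H' ?H /= ?orbF => /orP[]/eqP ?; subst v;
    rewrite ?eqxx // in yv *; by rewrite ?eqxx ?orbT.
(* Conversely, each listed tuple is a permutation of [a, b, c, d], hence duplicate-free, and has the
   same four sides. *)
have su : forall x y z v, perm_eq [:: x; y; z; v] [:: a; b; c; d] ->
  uniq [:: x; y; z; v] by move=> ? ? ? ? /perm_uniq->.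
have s2 x1 y1 : [set x1; y1] = [set y1; x1] by rewrite setUC.
have fin x1 y1 z1 v1 : uniq [:: x1; y1; z1; v1] ->
    [set [set x1; y1]; [set y1; z1]; [set z1; v1]; [set v1; x1]]
    = polygon [:: a; b; c; d] ->
    uniq [:: x1; y1; z1; v1] && (polygon [:: x1; y1; z1; v1] == polygon [:: a; b; c; d]).
  by move=> u1 <-; rewrite u1 polygon4 // eqxx.
repeat case/orP; case/and4P=> /eqP-> /eqP-> /eqP-> /eqP->; apply: fin;
  rewrite ?polygon4 //;
  try by [apply: su; apply/seq.permP=> p /=; case: (p a) (p b) (p c) (p d) => [] [] [] []].
all: apply/setP=> e; rewrite !inE.
all: rewrite ?(s2 b a) ?(s2 c b) ?(s2 d c) ?(s2 a d).
all: by case: (e == [set a; b]) (e == [set b; c]) (e == [set c; d]) => [] [] []; rewrite ?orbT ?orbF.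
Qed.

Lemma uniq_dihedral4 a b c d : uniq [:: a; b; c; d] -> uniq (dihedral4 a b c d).
Proof.
rewrite /dihedral4 /= !inE !negb_or !andbT.
move=> /and3P[/and3P[ab ac ad] /andP[bc bd] cd].
have H := (negPf ab, negPf ac, negPf ad, negPf bc, negPf bd, negPf cd).
have H' := (eq_sym b a, eq_sym c a, eq_sym d a, eq_sym c b, eq_sym d b, eq_sym d c).
by rewrite -!val_eqE /= !eqseq_cons ?eqxx ?H' ?H /= ?andbF.
Qed.

(** The adjacency matrix indexed by vertices; the value 0 off the edges lets sums run over all
    tuples. *)
Definition adj_weight a b : R := if adjacent a b then weight [set a; b] else 0.

Lemma adj_weightC a b : adj_weight a b = adj_weight b a.
Proof. by rewrite /adj_weight /adjacent /= setUC. Qed.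

Lemma sum_tuple4 (F : 4.-tuple V -> R) :
  \sum_t F t = \sum_a \sum_b \sum_c \sum_d F [tuple a; b; c; d].
Proof.
pose f (p : V * (V * (V * V))) := [tuple p.1; p.2.1; p.2.2.1; p.2.2.2].
pose g (t : 4.-tuple V) : V * (V * (V * V)) :=
  (tnth t ord0, (tnth t (inord 1), (tnth t (inord 2), tnth t (inord 3)))).
have fK : cancel g f by move=> t; rewrite [RHS]tuple4_eta.
have gK : cancel f g.
  by case=> a [b [c d]]; rewrite /g /f !(tnth_nth a) /= !inordK.
rewrite (reindex f) /=; last by exists g => p _.
rewrite (pair_bigA _ (fun a b => \sum_c \sum_d F [tuple a; b; c; d])) /=.
rewrite -(pair_bigA _ (fun a p => F (f (a, p)))) /=.
rewrite -(pair_bigA _ (fun a b => \sum_c \sum_d F [tuple a; b; c; d])) /=.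
apply: eq_bigr => a _; rewrite -(pair_bigA _ (fun b p => F (f (a, (b, p))))) /=.
by apply: eq_bigr => b _; rewrite -(pair_bigA _ (fun c d => F (f (a, (b, (c, d)))))).
Qed.

Lemma cycle_sum4_tuples :
  cycle_sum G 4 *+ 8 = \sum_a \sum_b \sum_c \sum_d
    (if uniq [:: a; b; c; d] then
       adj_weight a b * adj_weight b c * adj_weight c d * adj_weight d a else 0).
Proof.
pose P := [set t : 4.-tuple V | path.cycle (adjacent (G := G)) t & uniq t].
pose F (C : {set {set V}}) := \prod_(e in C) weight e.
have -> : cycle_sum G 4 *+ 8 = \sum_(t in P) F (polygon t).
  rewrite /cycle_sum -sumrMnl.
  (* Tuples are grouped by polygon; the fibre over [polygon t0] is the dihedral class of [t0], on
     which the summand is constant. *)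
  rewrite (partition_big_imset (fun t : 4.-tuple V => polygon t)) /=.
  apply: eq_bigr => C /imsetP[t0 Pt0 ->].
  rewrite [RHS](eq_bigr (fun=> F (polygon t0))); last by move=> t /andP[_ /eqP->].
  rewrite sumr_const; congr (_ *+ _); move: Pt0.
  elim/tuple4_ind: t0 => a b c d; rewrite inE [tval _]/= => /andP[cyc u].
  rewrite -[8%N]/(size (dihedral4 a b c d)) -(card_uniqP (uniq_dihedral4 _ _ _ _ u)).
  apply: eq_card => t; rewrite -polygon4_eq // unfold_in /= inE.
  case ut : (uniq t); rewrite ?andbF //= andbT.
  case: eqP => //; rewrite ?andbT ?andbF // => E.
  (* Being a closed walk is inherited from [[:: a; b; c; d]] through the common polygon. *)
  elim/tuple4_ind: t ut E => x y z v; rewrite [tval _]/= => ut E.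
  by rewrite cycle_polygon4 // E -cycle_polygon4.
rewrite big_mkcond sum_tuple4.
do 4![apply: eq_bigr => ? _].
rewrite inE [tval _]/=; case u: (uniq _); rewrite ?andbF // andbT /F (prod_polygon4 (weight (w := G))) //.
(* A tuple that is not a closed walk has a zero factor on the right. *)
rewrite /adj_weight /= andbT.
by do 4!case: (adjacent _ _); rewrite ?mulr0 ?mul0r.
Qed.

End FourCycles.

(** * Inclusion-exclusion over coincident indices *)

(** By symmetry, [a = c] turns the product into [m a b ^+ 2 * m a d ^+ 2], which sums to the squares
    of the row sums of [m a b ^+ 2]; [b = d] gives the same total, whence the factor 2. Both at once
    give [m a b ^+ 4], subtracted twice and so restored once. *)
Lemma sum_uniq4 (R : comNzRingType) (V : finType) (m : V -> V -> R) :
  (forall a b, m a b = m b a) -> (forall a, m a a = 0) ->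
  \sum_a \sum_b \sum_c \sum_d
    (if uniq [:: a; b; c; d] then m a b * m b c * m c d * m d a else 0)
  = \sum_a \sum_b \sum_c \sum_d m a b * m b c * m c d * m d a
    - 2%:R * \sum_a (\sum_b m a b ^+ 2) ^+ 2 + \sum_a \sum_b m a b ^+ 4.
Proof.
move=> mC m0.
pose T a b c d := m a b * m b c * m c d * m d a.
(* Each equation has the variable to be summed out on the left, the form that [pick1] expects. *)
have uniqE a b c d : (if uniq [:: a; b; c; d] then T a b c d else 0)
    = T a b c d - (if c == a then T a b c d else 0)
      - (if d == b then T a b c d else 0)
      + (if c == a then if d == b then T a b c d else 0 else 0).
  rewrite /= !inE !negb_or !andbT (eq_sym c a) (eq_sym d b).
  (* When two cyclically consecutive indices agree, a diagonal factor annihilates every term. *)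
  have [<-|_] := eqVneq a b; first by rewrite /T m0 !mul0r !if_same !subr0 addr0.
  have [<-|_] := eqVneq b c.
    by rewrite /T m0 mulr0 !mul0r andbF !if_same !subr0 addr0.
  have [<-|_] := eqVneq c d; first by rewrite /T m0 mulr0 mul0r !andbF !if_same !subr0 addr0.
  have [<-|_] := eqVneq a d; first by rewrite /T m0 mulr0 !andbF !if_same !subr0 addr0.
  by case: (a == c) (b == d) => [] [] /=; ring.
under eq_bigr do under eq_bigr do under eq_bigr do under eq_bigr do
  rewrite -/(T _ _ _ _) uniqE.
have pick1 (x : V) (F : V -> R) : \sum_y (if y == x then F y else 0) = F x.
  by rewrite -big_mkcond big_pred1_eq.
have split4 (F1 F2 F3 F4 : V -> V -> V -> V -> R) :
    \sum_a \sum_b \sum_c \sum_d (F1 a b c d - F2 a b c d - F3 a b c d + F4 a b c d)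
    = \sum_a \sum_b \sum_c \sum_d F1 a b c d - \sum_a \sum_b \sum_c \sum_d F2 a b c d
      - \sum_a \sum_b \sum_c \sum_d F3 a b c d + \sum_a \sum_b \sum_c \sum_d F4 a b c d.
  rewrite -!sumrB -big_split; apply: eq_bigr => a _ /=.
  rewrite -!sumrB -big_split; apply: eq_bigr => b _ /=.
  rewrite -!sumrB -big_split; apply: eq_bigr => c _ /=.
  by rewrite -!sumrB -big_split.
rewrite split4.
have -> : \sum_a \sum_b \sum_c \sum_d (if c == a then T a b c d else 0)
    = \sum_a (\sum_b m a b ^+ 2) ^+ 2.
  apply: eq_bigr => a _; rewrite expr2 mulr_suml; apply: eq_bigr => b _.
  rewrite exchange_big mulr_sumr; apply: eq_bigr => d _ /=.
  by rewrite pick1 /T (mC b a) (mC d a); ring.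
have -> : \sum_a \sum_b \sum_c \sum_d (if d == b then T a b c d else 0)
    = \sum_a (\sum_b m a b ^+ 2) ^+ 2.
  (* The outer sums are exchanged so that the repeated index [b] comes first. *)
  rewrite exchange_big; apply: eq_bigr => b _; rewrite expr2 mulr_suml.
  apply: eq_bigr => a _; rewrite mulr_sumr; apply: eq_bigr => c _ /=.
  by rewrite pick1 /T (mC a b) (mC c b); ring.
have -> : \sum_a \sum_b \sum_c \sum_d
      (if c == a then if d == b then T a b c d else 0 else 0)
    = \sum_a \sum_b m a b ^+ 4.
  apply: eq_bigr => a _; apply: eq_bigr => b _.
  rewrite exchange_big; under eq_bigr do rewrite pick1.
  by rewrite pick1 /T (mC b a); ring.
by rewrite /T; ring.
Qed.

(** * Matrix and entrywise forms of the functional, and division by 8 *)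

Lemma mxtrace_exp4 (R : comNzRingType) (n : nat) (M : 'M[R]_n) :
  \tr (M ^+ 4) = \sum_i \sum_j \sum_k \sum_l M i j * M j k * M k l * M l i.
Proof.
rewrite /mxtrace; apply: eq_bigr => i _.
rewrite !exprS expr0 mulr1 mxE; apply: eq_bigr => j _.
rewrite mxE mulr_sumr; apply: eq_bigr => k _.
rewrite mxE !mulr_sumr; apply: eq_bigr => l _.
by rewrite !mulrA.
Qed.

(** The trace of the squared Hadamard square has terms [M i j ^+ 2 * M j i ^+ 2]; symmetry merges
    them into fourth powers. *)
Lemma Phi4_symmetric (n : nat) (M : 'M[Zwr]_n) : M^T = M -> Phi4 M = Phi4_entries M.
Proof.
move=> Msym; have MC i j : M i j = M j i by rewrite -{1}Msym mxE.
rewrite /Phi4 /Phi4_entries; congr (_ *: toQ (_ - _ * _ + _)).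
  rewrite /sqnorm mxE; apply: eq_bigr => i _.
  rewrite !mxE -expr2; congr (_ ^+ 2); apply: eq_bigr => j _.
  by rewrite !mxE mulr1.
rewrite /mxtrace; apply: eq_bigr => i _; rewrite expr2 mxE; apply: eq_bigr => j _.
by rewrite !mxE (MC j i) -exprD.
Qed.

(** Eight is invertible over the rationals, so an eightfold count established over the integers can
    be divided after [toQ]. *)
Lemma toQ_div8 (p q : Zwr) : p *+ 8 = q -> toQ p = (8%:R : rat)^-1 *: toQ q.
Proof.
by move=> <-; rewrite /toQ raddfMn -scaler_nat scalerA mulVf ?scale1r.
Qed.

(** * Passage from vertex sums to adjacency matrices *)

Section Adjacency.
Variables (R : comNzRingType) (G : wgraph R).

Lemma adjacencyE i j :
  adjacency G i j = adj_weight R G (enum_val i) (enum_val j).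
Proof. by rewrite mxE. Qed.

Lemma sum_enum_val (F : vertex G -> R) : \sum_v F v = \sum_(i < #|vertex G|) F (enum_val i).
Proof. by rewrite (reindex _ (onW_bij _ (enum_val_bij _))). Qed.

Lemma cycle_sum4 : (forall v, [set v] \notin edges G) ->
  let A := adjacency G in
  cycle_sum G 4 *+ 8 = \sum_i \sum_j \sum_k \sum_l A i j * A j k * A k l * A l i
    - 2%:R * \sum_i (\sum_j A i j ^+ 2) ^+ 2 + \sum_i \sum_j A i j ^+ 4.
Proof.
move=> loopless A; rewrite cycle_sum4_tuples sum_uniq4; first last.
(* [[set a; a]] is [[set a]], so a nonzero diagonal entry would need a loop. *)
- by move=> a; rewrite /adj_weight /adjacent /= setUid (negPf (loopless a)).
- exact: adj_weightC.
congr (_ - _ * _ + _).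
- rewrite sum_enum_val; apply: eq_bigr => i _; rewrite sum_enum_val; apply: eq_bigr => j _.
  rewrite sum_enum_val; apply: eq_bigr => k _; rewrite sum_enum_val; apply: eq_bigr => l _.
  by rewrite !adjacencyE.
- rewrite sum_enum_val; apply: eq_bigr => i _; rewrite sum_enum_val.
  by congr (_ ^+ 2); apply: eq_bigr => j _; rewrite adjacencyE.
- rewrite sum_enum_val; apply: eq_bigr => i _; rewrite sum_enum_val; apply: eq_bigr => j _.
  by rewrite adjacencyE.
Qed.

End Adjacency.

Lemma Phi4_cycle_sum (G : wgraph Zwr) :
  (forall v, [set v] \notin edges G) -> toQ (cycle_sum G 4) = Phi4 (adjacency G).
Proof.
move=> loopless; rewrite Phi4_symmetric.
  by apply: toQ_div8; rewrite cycle_sum4 // mxtrace_exp4.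
by apply/matrixP=> i j; rewrite mxE !adjacencyE adj_weightC.
Qed.

(** * Tait graphs of reduced diagrams and the link invariant *)

(** A loop would come from a crossing whose two corners at level [b] lie in one region, which makes
    it nugatory. *)
Lemma reduced_tait_loopless (D : gauss_code) (b : bool) : reduced D ->
  forall v, [set v] \notin edges (consolidate (tait_graph D b)).
Proof.
move=> /forallP red v; apply/imsetP=> -[x _ /= e].
have := red x; rewrite negb_exists => /forallP /(_ b) /negP; apply.
have /set1P e1 : corner_region b x true \in [set v] by rewrite e !inE eqxx.
have /set1P e2 : corner_region b x false \in [set v] by rewrite e !inE eqxx orbT.
by have [->] : corner_region b x true = corner_region b x false by rewrite e1 e2.
Qed.

Theorem theorem6p2 (rule : bool) (L : link)
    (Hnonsplit : non_split L) (Halt : alternating_link L) :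
  (forall D : diagram, reduced_alternating_diagram L D ->
     let A_B := adjacency (G_B rule D) in
     let A_W := adjacency (G_W rule D) in
     pair_toQ (CWR_diagram rule 4 D) = (Phi4 A_B, Phi4 A_W) /\
     (CWR_well_defined rule 4 L ->
        pair_toQ (CWR rule 4 L) = (Phi4 A_B, Phi4 A_W))) /\
  (forall (n : nat) (M : 'M[Zwr]_n),
     M^T = M -> (forall i : 'I_n, M i i = 0) -> Phi4 M = Phi4_entries M).
Proof.
split=> [D rD A_B A_W|n M Msym _]; last exact: Phi4_symmetric.
have CWR4 : pair_toQ (CWR_diagram rule 4 D) = (Phi4 A_B, Phi4 A_W).
  have [_ _ red] := rD.
  by rewrite /pair_toQ /= !Phi4_cycle_sum //; apply: reduced_tait_loopless.
split=> // wd; rewrite -CWR4; congr pair_toQ.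
symmetry; rewrite /CWR.
(* Well-definedness makes the predicate defining [CWR] satisfiable, with the value on [D] as
   witness; the value chosen by [epsilon] then agrees with it on [D]. *)
apply: (epsilon_spec _ (fun c => forall E : diagram,
  reduced_alternating_diagram L E -> CWR_diagram rule 4 E = c) _ D rD).
by exists (CWR_diagram rule 4 D) => E rE; apply: wd.
Qed.
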